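(* Let $G$ be a finite simple graph which is both cricket-free and gap-free. Then $\operatorname{reg}(I(G))\leq 3$. *)

(* Defs.v *)
From HB Require Import structures.
From mathcomp Require Import all_boot all_order all_algebra.
From mathcomp Require Import mpoly.
Set Implicit Arguments. Unset Strict Implicit. Unset Printing Implicit Defensive.
Import Order.TTheory GRing.Theory.
Local Open Scope ring_scope.

Definition simple_graph (n : nat) (e : rel 'I_n) : Prop :=
  (forall x y, e x y = e y x) /\ (forall x, ~~ e x x).

Definition has_induced (m n : nat) (h : rel 'I_m) (e : rel 'I_n) : Prop :=
  exists f : 'I_m -> 'I_n, injective f /\ forall x y, e (f x) (f y) = h x y.

(* The cricket: vertex 0 adjacent to 1,2,3,4 and the extra edge 1-2
   (a triangle with two pendant edges at the same vertex). *)
Definition cricket : rel 'I_5 := fun x y =>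
  let a := val x in let b := val y in
  [|| (a == 0%N) && (b != 0%N), (b == 0%N) && (a != 0%N),
      (a == 1%N) && (b == 2%N) | (a == 2%N) && (b == 1%N)].

Definition twoK2 : rel 'I_4 := fun x y =>
  let a := val x in let b := val y in
  [|| (a == 0%N) && (b == 1%N), (a == 1%N) && (b == 0%N),
      (a == 2%N) && (b == 3%N) | (a == 3%N) && (b == 2%N)].

Definition cricket_free (n : nat) (e : rel 'I_n) : Prop := ~ has_induced cricket e.
Definition gap_free (n : nat) (e : rel 'I_n) : Prop := ~ has_induced twoK2 e.

Arguments cricket : clear implicits.
Definition in_edge_ideal (k : fieldType) (n : nat) (e : rel 'I_n)
    (p : {mpoly k[n]}) : Prop :=
  exists c : 'I_n -> 'I_n -> {mpoly k[n]},
    p = \sum_(i < n) \sum_(j < n | e i j) c i j * ('X_i * 'X_j).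

(* Homogeneity for the standard grading (deg x_i = 1); 0 is homogeneous
   of every degree. *)
Definition homog_of (k : fieldType) (n : nat) (d : nat) (p : {mpoly k[n]}) : bool :=
  p \is @ishomog1 n k d mdeg.

(* A minimal graded free resolution of the ideal I (given as a predicate):
     ... -> F_2 --d 1--> F_1 --d 0--> F_0 --g--> I -> 0
   F_i = (+)_{j < r i} S(-(a i j)), elements are row vectors 'rV_(r i),
   d i : 'M_(r i.+1, r i) acts by v |-> v *m d i, and g : 'cV_(r 0) lists the
   images of the basis of F_0.  Graded: every entry is homogeneous of the
   degree difference; minimal: every differential has entries in the
   homogeneous maximal ideal (nonzero entries have positive degree). *)
Definition min_graded_free_res (k : fieldType) (n : nat)
    (I : {mpoly k[n]} -> Prop)
    (r : nat -> nat) (a : nat -> nat -> nat)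
    (g : 'cV[{mpoly k[n]}]_(r 0%N))
    (d : forall i : nat, 'M[{mpoly k[n]}]_(r i.+1, r i)) : Prop :=
  (forall j : 'I_(r 0%N), homog_of (a 0%N j) (g j 0)) /\
  (forall (i : nat) (j : 'I_(r i.+1)) (l : 'I_(r i)),
      homog_of (a i.+1 j - a i l)%N (d i j l) /\
      (d i j l != 0 -> (a i l < a i.+1 j)%N)) /\
  (forall p, I p <-> exists v : 'rV_(r 0%N), p = (v *m g) 0 0) /\
  (forall v : 'rV_(r 0%N),
      v *m g = 0 <-> exists w : 'rV_(r 1%N), v = w *m d 0%N) /\
  (forall (i : nat) (v : 'rV_(r i.+1)),
      v *m d i = 0 <-> exists w : 'rV_(r i.+2), v = w *m d i.+1).

(* reg(I) <= b : in the minimal graded free resolution of I, every shift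
   a_{ij} (i.e. every j with beta_{i,j}(I) != 0) satisfies a_{ij} - i <= b. *)
Definition reg_le (k : fieldType) (n : nat) (I : {mpoly k[n]} -> Prop) (b : nat) : Prop :=
  exists (r : nat -> nat) (a : nat -> nat -> nat)
         (g : 'cV[{mpoly k[n]}]_(r 0%N))
         (d : forall i : nat, 'M[{mpoly k[n]}]_(r i.+1, r i)),
    min_graded_free_res I a g d /\
    forall (i : nat) (j : 'I_(r i)), (a i j <= i + b)%N.
Arguments in_edge_ideal k [n] e p.

(* Main.v *)
(* For a vertex x of G, the edge ideal satisfies I = I' + xK with I' = I(G - x) and
   K = (I : x) = (N(x)) + I(G - N[x]).  The exact sequence
   0 -> I'(-1) -> I' (+) K(-1) -> I -> 0 gives
   reg I <= max (reg I', reg K + 1), and adjoining the variables N(x) does not raise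
   the regularity (if it is positive).  So it suffices, at each vertex x with a
   neighbour y, to bound by 2 the regularity of U = G - N[x].  In U, gap-freeness
   (against the edge xy) makes the non-neighbours of y edgeless, and cricket-freeness
   (centre y, leaf x) makes the neighbours of y complete multipartite; then some
   vertex t of U has an edgeless set of non-neighbours, and one recurses on t.
   Regularity is bounded through arbitrary graded free resolutions; a minimal one is
   then extracted by discarding redundant generators. *)
Require Import Defs.
From HB Require Import structures.
From mathcomp Require Import all_boot all_order all_algebra.
From mathcomp Require Import mpoly.
From Stdlib Require Import Classical ClassicalEpsilon.

Set Implicit Arguments. Unset Strict Implicit. Unset Printing Implicit Defensive.
Import Order.TTheory GRing.Theory.
Local Open Scope ring_scope.

(** * Graded components of polynomials *)

Section Monomials.
Context (n : nat) (k : fieldType).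
Implicit Types (p q : {mpoly k[n]}) (P : pred 'X_{1..n}).

Definition mfilter P p : {mpoly k[n]} :=
  \sum_(m <- msupp p | P m) p@_m *: 'X_[m].

Lemma mcoeff_mfilter P p m : (mfilter P p)@_m = if P m then p@_m else 0.
Proof.
rewrite /mfilter big_mkcond raddf_sum /=.
transitivity (\sum_(m' <- msupp p) if P m then (p@_m' *: 'X_[m'])@_m else 0).
  apply: eq_bigr => m' _; case: (eqVneq m' m) => [->|ne_m].
    by case: ifP => //; rewrite mcoeff0.
  have cm : (p@_m' *: 'X_[m'])@_m = 0.
    by rewrite mcoeffZ mcoeffX (negbTE ne_m) mulr0.
  by case: ifP; case: ifP; rewrite ?mcoeff0 ?cm.
case: ifP => _; last by rewrite big1.
by rewrite -raddf_sum -mpolyE.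
Qed.

Lemma mfilterD P : {morph mfilter P : p q / p + q}.
Proof.
move=> p q; apply/mpolyP => m; rewrite mcoeffD !mcoeff_mfilter mcoeffD.
by case: ifP; rewrite ?addr0.
Qed.

Lemma mfilterZ P c p : mfilter P (c *: p) = c *: mfilter P p.
Proof.
apply/mpolyP => m; rewrite mcoeffZ !mcoeff_mfilter mcoeffZ.
by case: ifP; rewrite ?mulr0.
Qed.

Lemma mfilter0 P : mfilter P 0 = 0.
Proof. by apply/mpolyP => m; rewrite mcoeff_mfilter mcoeff0; case: ifP. Qed.

Lemma mfilter_sum P I (r : seq I) (F : I -> {mpoly k[n]}) :
  mfilter P (\sum_(i <- r) F i) = \sum_(i <- r) mfilter P (F i).
Proof. exact: (big_morph _ (@mfilterD P) (@mfilter0 P)). Qed.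

Lemma mfilter_id P p : {in msupp p, forall m, P m} -> mfilter P p = p.
Proof.
move=> Pp; apply/mpolyP => m; rewrite mcoeff_mfilter.
case: ifPn => // NPm; apply/esym/eqP; rewrite mcoeff_eq0.
by apply: contra NPm => /Pp.
Qed.

Lemma mfilter_eq0 P p : {in msupp p, forall m, ~~ P m} -> mfilter P p = 0.
Proof.
move=> Pp; apply/mpolyP => m; rewrite mcoeff_mfilter mcoeff0.
case: ifPn => // Pm; apply/eqP; rewrite mcoeff_eq0.
by apply/negP => /Pp; rewrite Pm.
Qed.

(* [p] is homogeneous of degree [t] in the shifted free module S(-a); as there
   is no truncated subtraction, this forces [p = 0] when [t < a]. *)
Definition shomog (a t : nat) p := {in msupp p, forall m, (mdeg m + a = t)%N}.

Definition scomp (a t : nat) p := mfilter (fun m => mdeg m + a == t)%N p.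

Lemma shomog_scomp a t p : shomog a t (scomp a t p).
Proof.
move=> m; rewrite mcoeff_msupp mcoeff_mfilter; case: ifPn => [/eqP|]//.
by rewrite eqxx.
Qed.

Lemma shomog0 a t : shomog a t 0.
Proof. by move=> m; rewrite msupp0. Qed.

Lemma shomog1 a : shomog a a 1.
Proof. by move=> m; rewrite msupp1 inE => /eqP->; rewrite mdeg0. Qed.

Lemma shomogX a (i : 'I_n) : shomog a a.+1 'X_i.
Proof. by move=> m; rewrite msuppX inE => /eqP->; rewrite mdeg1. Qed.

Lemma shomogD a t p q : shomog a t p -> shomog a t q -> shomog a t (p + q).
Proof.
move=> hp hq m /msuppD_le; rewrite mem_cat => /orP[]; [exact: hp|exact: hq].
Qed.

Lemma shomogN a t p : shomog a t p -> shomog a t (- p).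
Proof. by move=> hp m; rewrite (perm_mem (msuppN p)); apply: hp. Qed.

Lemma shomogM a b t p q : shomog b t p -> shomog a b q -> shomog a t (p * q).
Proof.
move=> hp hq m /msuppM_le /allpairsP[[m1 m2] /= [/hp h1 /hq h2 ->]].
by rewrite mdegD -h1 -h2 addnA.
Qed.

Lemma shomog_sum a t I (r : seq I) (F : I -> {mpoly k[n]}) :
  (forall i, shomog a t (F i)) -> shomog a t (\sum_(i <- r) F i).
Proof.
by move=> hF; elim/big_ind: _ => //; [exact: shomog0|exact: shomogD].
Qed.

(** By linearity in [p] it is enough to treat a monomial. Its product with the homogeneous [q] lies
    in a single degree, so the filter keeps or kills both sides together. *)
Lemma scompM a b t p q :
  shomog a b q -> scomp a t (p * q) = scomp b t p * q.
Proof.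
move=> hq; rewrite (mpolyE p) mulr_suml /scomp !mfilter_sum mulr_suml.
apply: eq_bigr => m _; rewrite -scalerAl !mfilterZ -scalerAl.
congr (_ *: _).
have sXq m' : m' \in msupp ('X_[m] * q) -> (mdeg m' + a = mdeg m + b)%N.
  move/msuppM_le/allpairsP=> [[m1 m2] /= [h1 /hq h2 ->]].
  by move: h1; rewrite msuppX inE => /eqP->; rewrite mdegD -h2 addnA.
case: (eqVneq (mdeg m + b)%N t) => [tE|ntE].
  rewrite !mfilter_id // => m'; first by rewrite msuppX inE => /eqP->; apply/eqP.
  by move/sXq => ->; apply/eqP.
rewrite !mfilter_eq0 ?mul0r // => m'.
  by rewrite msuppX inE => /eqP->.
by move/sXq => ->.
Qed.

Lemma scomp_id a t p : shomog a t p -> scomp a t p = p.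
Proof. by move=> hp; apply: mfilter_id => m /hp ->. Qed.

End Monomials.

(** * Degree-preserving maps between graded free modules *)

Section GradedMatrices.
Context (n : nat) (k : fieldType).
Local Notation S := {mpoly k[n]}.

(* The matrix of a degree-preserving map from the free module with basis degrees
   [a'] to the one with basis degrees [a], acting on row vectors. *)
Definition hmx m' m (a' : 'I_m' -> nat) (a : 'I_m -> nat) (d : 'M[S]_(m', m)) :=
  forall i j, shomog (a j) (a' i) (d i j).

Definition vcomp m (a : 'I_m -> nat) t (v : 'rV[S]_m) : 'rV[S]_m :=
  \row_j scomp (a j) t (v 0 j).

Lemma hmxM m1 m2 m3 (a1 : 'I_m1 -> nat) (a2 : 'I_m2 -> nat) (a3 : 'I_m3 -> nat)
    (A : 'M[S]_(m1, m2)) (B : 'M[S]_(m2, m3)) :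
  hmx a1 a2 A -> hmx a2 a3 B -> hmx a1 a3 (A *m B).
Proof.
move=> hA hB i j; rewrite mxE; apply: shomog_sum => l.
exact: shomogM (hA i l) (hB l j).
Qed.

Lemma hmxD m1 m2 (a1 : 'I_m1 -> nat) (a2 : 'I_m2 -> nat)
    (A B : 'M[S]_(m1, m2)) :
  hmx a1 a2 A -> hmx a1 a2 B -> hmx a1 a2 (A + B).
Proof. by move=> hA hB i j; rewrite mxE; apply: shomogD. Qed.

Lemma hmxN m1 m2 (a1 : 'I_m1 -> nat) (a2 : 'I_m2 -> nat) (A : 'M[S]_(m1, m2)) :
  hmx a1 a2 A -> hmx a1 a2 (- A).
Proof. by move=> hA i j; rewrite mxE; apply: shomogN. Qed.

Lemma hmx0 m1 m2 (a1 : 'I_m1 -> nat) (a2 : 'I_m2 -> nat) : hmx a1 a2 0.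
Proof. by move=> i j; rewrite mxE; apply: shomog0. Qed.

Lemma hmx1 m (a : 'I_m -> nat) : hmx a a 1%:M.
Proof.
move=> i j; rewrite mxE; case: eqP => [->|_]; [exact: shomog1|exact: shomog0].
Qed.

Definition dcat m1 m2 (a1 : 'I_m1 -> nat) (a2 : 'I_m2 -> nat)
    (i : 'I_(m1 + m2)) : nat :=
  match split i with inl i1 => a1 i1 | inr i2 => a2 i2 end.

Lemma hmx_col m1 m2 m (a1 : 'I_m1 -> nat) (a2 : 'I_m2 -> nat) (a : 'I_m -> nat)
    (A : 'M[S]_(m1, m)) (B : 'M[S]_(m2, m)) :
  hmx a1 a A -> hmx a2 a B -> hmx (dcat a1 a2) a (col_mx A B).
Proof. by move=> hA hB i j; rewrite mxE /dcat; case: (split i). Qed.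

Lemma hmx_row m1 m2 m (a1 : 'I_m1 -> nat) (a2 : 'I_m2 -> nat) (a : 'I_m -> nat)
    (A : 'M[S]_(m, m1)) (B : 'M[S]_(m, m2)) :
  hmx a a1 A -> hmx a a2 B -> hmx a (dcat a1 a2) (row_mx A B).
Proof. by move=> hA hB i j; rewrite mxE /dcat; case: (split j). Qed.

Lemma vcompM m' m (a' : 'I_m' -> nat) (a : 'I_m -> nat) (d : 'M[S]_(m', m)) t v :
  hmx a' a d -> vcomp a t (v *m d) = vcomp a' t v *m d.
Proof.
move=> hd; apply/rowP => j; rewrite !mxE /scomp mfilter_sum.
by apply: eq_bigr => i _; rewrite mxE; apply: scompM.
Qed.

Lemma hmx_vcomp m (a : 'I_m -> nat) t v : hmx (fun=> t) a (vcomp a t v).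
Proof. by move=> i j; rewrite mxE; apply: shomog_scomp. Qed.

Lemma vcomp_id m (a : 'I_m -> nat) t v : hmx (fun=> t) a v -> vcomp a t v = v.
Proof. by move=> hv; apply/rowP => j; rewrite mxE scomp_id. Qed.

Lemma vcomp0 m (a : 'I_m -> nat) t : vcomp a t 0 = 0.
Proof. by apply/rowP => j; rewrite !mxE /scomp mfilter0. Qed.

Lemma hmx_row_of m' m (a' : 'I_m' -> nat) (a : 'I_m -> nat) (d : 'M[S]_(m', m)) i :
  hmx a' a d -> hmx (fun=> a' i) a (row i d).
Proof. by move=> hd i' j; rewrite mxE. Qed.

End GradedMatrices.

(** * Graded free resolutions and their behaviour in short exact sequences *)

Section Resolutions.
Context (n : nat) (k : fieldType).
Local Notation S := {mpoly k[n]}.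

(* The submodule [M] of the free module with basis degrees [a] has a graded free
   resolution of length [L] whose [i]-th term is generated in degrees
   [<= c + i].  Minimality is not required: this is what makes the class stable
   under extensions and quotients. *)
Fixpoint fres (L c m : nat) (a : 'I_m -> nat) (M : 'rV[S]_m -> Prop) : Prop :=
  if L is L'.+1 then
    exists m' (a' : 'I_m' -> nat) (d : 'M[S]_(m', m)),
      [/\ forall j, (a' j <= c)%N, hmx a' a d,
          forall v, M v <-> exists w, v = w *m d
        & fres L' c.+1 a' (fun w => w *m d = 0)]
  else forall v, M v <-> v = 0.

Definition regular c m (a : 'I_m -> nat) M := exists L, fres L c a M.

Definition gsubmod m (a : 'I_m -> nat) (M : 'rV[S]_m -> Prop) : Prop :=
  [/\ forall v w, M v -> M w -> M (v + w),
      forall (s : S) v, M v -> M (s *: v)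
    & forall t v, M v -> M (vcomp a t v)].

Lemma gsubmod_ker m' m (a' : 'I_m' -> nat) (a : 'I_m -> nat) (d : 'M[S]_(m', m)) :
  hmx a' a d -> gsubmod a' (fun w => w *m d = 0).
Proof.
move=> hd; split=> [v w|s v|t v] => [v0 w0|v0|v0].
- by rewrite mulmxDl v0 w0 addr0.
- by rewrite -scalemxAl v0 scaler0.
- by rewrite -(vcompM _ _ hd) v0 vcomp0.
Qed.

Lemma gsubmodB m (a : 'I_m -> nat) M v w :
  gsubmod a M -> M v -> M w -> M (v - w).
Proof. by case=> MD MZ _ Mv Mw; apply: MD => //; rewrite -scaleN1r; apply: MZ. Qed.

Lemma gsubmod_mul m (a : 'I_m -> nat) M m' (d : 'M[S]_(m', m)) w :
  gsubmod a M -> M 0 -> (forall j, M (row j d)) -> M (w *m d).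
Proof.
case=> MD MZ _ M0 Md; rewrite mulmx_sum_row.
by elim/big_ind: _ => // j _; apply: MZ.
Qed.

Lemma fres_ext L c m (a : 'I_m -> nat) M M' :
  (forall v, M v <-> M' v) -> fres L c a M -> fres L c a M'.
Proof.
move=> eM; case: L => [|L] /=; first by move=> M0 v; rewrite -eM.
move=> [m' [a' [d [a'c hd Md res]]]]; exists m', a', d; split=> // v.
by rewrite -eM.
Qed.

Lemma fres_zero L c m (a : 'I_m -> nat) M :
  (forall v, M v <-> v = 0) -> fres L c a M.
Proof.
elim: L c m a M => [|L IH] c m a M M0 //=.
exists 0%N, (fun=> 0%N), 0; split=> [[]//|[]//|v|].
  rewrite M0; split=> [->|[w ->]]; last by rewrite mulmx0.
  by exists 0; rewrite mul0mx.
by apply: IH => w; split=> _; [apply/rowP => -[]|rewrite mulmx0].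
Qed.

Lemma fres_leL L L' c m (a : 'I_m -> nat) M :
  (L <= L')%N -> fres L c a M -> fres L' c a M.
Proof.
elim: L L' c m a M => [|L IH] [|L'] c m a M //= leL.
  exact: (@fres_zero L'.+1).
move=> [m' [a' [d [a'c hd Md res]]]]; exists m', a', d; split=> //.
exact: IH res.
Qed.

Lemma regular_ext c m (a : 'I_m -> nat) M M' :
  (forall v, M v <-> M' v) -> regular c a M -> regular c a M'.
Proof. by move=> eM [L res]; exists L; apply: fres_ext res. Qed.

Lemma regular_zero c m (a : 'I_m -> nat) M :
  (forall v, M v <-> v = 0) -> regular c a M.
Proof. by exists 0%N. Qed.

Lemma regular_gen c m m' (a' : 'I_m' -> nat) (a : 'I_m -> nat)
    (d : 'M[S]_(m', m)) M :
  (forall j, a' j <= c)%N -> hmx a' a d ->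
  (forall v, M v <-> exists w, v = w *m d) ->
  regular c.+1 a' (fun w => w *m d = 0) -> regular c a M.
Proof. by move=> a'c hd Md [L res]; exists L.+1; exists m', a', d. Qed.

Lemma regular_shift c m (a : 'I_m -> nat) M :
  regular c a M -> regular c.+1 (fun j => (a j).+1) M.
Proof.
case=> L res; exists L; elim: L c m a M res => [|L IH] c m a M //=.
move=> [m' [a' [d [a'c hd Md /IH res]]]].
exists m', (fun j => (a' j).+1), d; split=> //.
by move=> i j x /hd <-; rewrite addnS.
Qed.

(** Composing the generators of [M] with a map injective on [M] leaves their syzygies unchanged, so
    the tail of the resolution is reused. *)
Lemma fres_inj L c m m1 (a : 'I_m -> nat) (a1 : 'I_m1 -> nat) M
    (P : 'M[S]_(m, m1)) :
  hmx a a1 P -> (forall v, M v -> v *m P = 0 -> v = 0) ->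
  fres L c a M -> fres L c a1 (fun u => exists2 v, M v & u = v *m P).
Proof.
move=> hP injP; case: L => [|L] /= res.
  move=> u; split=> [[v /res-> ->]|->]; first by rewrite mul0mx.
  by exists 0; [apply/res|rewrite mul0mx].
have [m' [a' [d [a'c hd Md res']]]] := res.
exists m', a', (d *m P); split=> //; first exact: hmxM hd hP.
  move=> u; split=> [[v /Md[w ->] ->]|[w ->]]; first by exists w; rewrite mulmxA.
  by exists (w *m d); [apply/Md; exists w|rewrite mulmxA].
apply: fres_ext res' => w; rewrite mulmxA; split=> [->|].
  by rewrite mul0mx.
by apply: injP; apply/Md; exists w.
Qed.

Lemma regular_inj c m m1 (a : 'I_m -> nat) (a1 : 'I_m1 -> nat) M
    (P : 'M[S]_(m, m1)) :
  hmx a a1 P -> (forall v, M v -> v *m P = 0 -> v = 0) ->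
  regular c a M -> regular c a1 (fun u => exists2 v, M v & u = v *m P).
Proof. by move=> hP injP [L res]; exists L; apply: fres_inj. Qed.

(** Each row is lifted arbitrarily, then replaced by the graded component in the degree of that row.
    The component stays in [B] and still maps to the row, which is homogeneous. *)
Lemma hom_lift m m1 (a : 'I_m -> nat) (a1 : 'I_m1 -> nat) B (P : 'M[S]_(m, m1))
    m' (a' : 'I_m' -> nat) (d : 'M[S]_(m', m1)) :
  hmx a a1 P -> hmx a' a1 d -> gsubmod a B ->
  (forall j, exists2 v, B v & row j d = v *m P) ->
  exists d' : 'M[S]_(m', m),
    [/\ hmx a' a d', d' *m P = d & forall j, B (row j d')].
Proof.
move=> hP hd [_ _ Bcomp] dB.
have lift1 j : exists v, [/\ B v, row j d = v *m P & hmx (fun=> a' j) a v].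
  have [v Bv dj] := dB j; exists (vcomp a (a' j) v); split; first exact: Bcomp.
    by rewrite -(vcompM _ _ hP) -dj vcomp_id //; apply: hmx_row_of.
  exact: hmx_vcomp.
pose f j := proj1_sig (constructive_indefinite_description _ (lift1 j)).
have fP j : [/\ B (f j), row j d = f j *m P & hmx (fun=> a' j) a (f j)].
  by rewrite /f; case: (constructive_indefinite_description _ _).
exists (\matrix_(j < m') f j); split=> [i j||j]; last by rewrite rowK; case: (fP j).
  by rewrite mxE; case: (fP i) => _ _; apply.
by apply/row_matrixP => j; rewrite row_mul rowK; case: (fP j).
Qed.

(** Horseshoe lemma for [0 -> A -> B -> C -> 0]: generators of [A] and lifts of generators of [C]
    generate [B], and the syzygy modules form a sequence of the same kind, handled by induction on
    [L]. *)
Lemma fres_horseshoe L c m m1 (a : 'I_m -> nat) (a1 : 'I_m1 -> nat) A B C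
    (P : 'M[S]_(m, m1)) :
  hmx a a1 P -> gsubmod a B ->
  (forall v, A v <-> B v /\ v *m P = 0) ->
  (forall u, C u <-> exists2 v, B v & u = v *m P) ->
  fres L c a A -> fres L c a1 C -> fres L c a B.
Proof.
elim: L c m m1 a a1 A B C P => [|L IH] c m m1 a a1 A B C P hP gB AE CE /=.
  move=> A0 C0 v; split=> [Bv|->]; last by have /AE[] : A 0 by apply/A0.
  by apply/A0/AE; split=> //; apply/C0/CE; exists v.
move=> [mA [aA [dA [aAc hA Adef resA]]]] [mC [aC [dC [aCc hC Cdef resC]]]].
have CdC j : exists2 v, B v & row j dC = v *m P.
  by apply/CE/Cdef; exists (delta_mx 0 j); rewrite rowE.
have [d' [hd' d'P Bd']] := hom_lift hP hC gB CdC.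
have BA v : A v -> B v by case/AE.
have B0 : B 0 by apply/BA/Adef; exists 0; rewrite mul0mx.
have hcol := hmx_col hA hd'.
exists (mA + mC)%N, (dcat aA aC), (col_mx dA d'); split=> //.
- by move=> j; rewrite /dcat; case: (split j).
- move=> v; split=> [Bv|[w ->]]; last first.
    rewrite -[w]hsubmxK mul_row_col; case: (gB) => BD _ _; apply: BD.
      by apply/BA/Adef; exists (lsubmx w).
    by apply: gsubmod_mul gB _ _.
  have /Cdef[w vP] : C (v *m P) by apply/CE; exists v.
  have /Adef[u uE] : A (v - w *m d').
    apply/AE; split; first by apply: (gsubmodB gB) => //; apply: gsubmod_mul gB _ _.
    by rewrite mulmxBl -mulmxA d'P vP subrr.
  by exists (row_mx u w); rewrite mul_row_col -uE subrK.
(* [Q] projects onto the coordinates of [C] and [J] includes those of [A]; they induce the exact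
   sequence of syzygy modules. *)
pose Q : 'M[S]_(mA + mC, mC) := col_mx 0 1%:M.
pose J : 'M[S]_(mA, mA + mC) := row_mx 1%:M 0.
have hQ : hmx (dcat aA aC) aC Q by apply: hmx_col; [exact: hmx0|exact: hmx1].
have hJ : hmx aA (dcat aA aC) J by apply: hmx_row; [exact: hmx1|exact: hmx0].
have vJ (v : 'rV_mA) : v *m J = row_mx v 0 by rewrite mul_mx_row mulmx1 mulmx0.
have vQ (v : 'rV_(mA + mC)) : v *m Q = rsubmx v.
  by rewrite -{1}[v]hsubmxK mul_row_col mulmx0 mulmx1 add0r.
have vcol (v : 'rV_(mA + mC)) :
    v *m col_mx dA d' = lsubmx v *m dA + rsubmx v *m d'.
  by rewrite -{1}[v]hsubmxK mul_row_col.
pose A' u := exists2 v : 'rV_mA, v *m dA = 0 & u = v *m J.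
have resA' : fres L c.+1 (dcat aA aC) A'.
  apply: (fres_inj hJ) resA => v _.
  by rewrite vJ => /(congr1 lsubmx); rewrite row_mxKl linear0.
apply: (IH c.+1 _ _ _ _ _ _ _ _ hQ (gsubmod_ker hcol) _ _ resA' resC) => [v|u].
  rewrite vQ vcol; split=> [[w wdA ->]|[]].
    by rewrite vJ row_mxKl row_mxKr wdA mul0mx addr0.
  move=> + v0; rewrite v0 mul0mx addr0 => vdA.
  by exists (lsubmx v); rewrite // vJ -{1}[v]hsubmxK v0.
split=> [udC|[v + ->]]; last first.
  rewrite vcol vQ => vE.
  rewrite -d'P mulmxA; move/eqP: vE; rewrite addr_eq0 => /eqP vE.
  have /AE[_] : A (lsubmx v *m dA) by apply/Adef; exists (lsubmx v).
  by rewrite vE mulNmx => /eqP; rewrite oppr_eq0 => /eqP.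
(* Surjectivity onto the syzygies of [dC]: applying the lifted generators to such a syzygy lands in
   [A], where the generators of [A] cancel the result. *)
have /Adef[w wE] : A (- (u *m d')).
  apply/AE; split; last by rewrite mulNmx -mulmxA d'P udC oppr0.
  rewrite -mulNmx; by apply: gsubmod_mul gB _ _.
by exists (row_mx w u); rewrite ?vQ ?row_mxKr // mul_row_col -wE addNr.
Qed.

Lemma regular_horseshoe c m m1 (a : 'I_m -> nat) (a1 : 'I_m1 -> nat) B C
    (P : 'M[S]_(m, m1)) :
  hmx a a1 P -> gsubmod a B ->
  (forall u, C u <-> exists2 v, B v & u = v *m P) ->
  regular c a (fun v => B v /\ v *m P = 0) -> regular c a1 C -> regular c a B.
Proof.
move=> hP gB CE [L1 res1] [L2 res2]; exists (maxn L1 L2).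
apply: (fres_horseshoe (A := fun v => B v /\ v *m P = 0) hP gB _ CE) => //.
  exact: fres_leL (leq_maxl _ _) res1.
exact: fres_leL (leq_maxr _ _) res2.
Qed.

(** Images of generators of [B] generate [C]. Via [d], their syzygies map onto the kernel of
    [B -> C], and what dies there is the syzygy module of [B]; the horseshoe lemma bounds this
    extension at level [c.+1]. *)
Lemma regular_quot c m m1 (a : 'I_m -> nat) (a1 : 'I_m1 -> nat) B C
    (P : 'M[S]_(m, m1)) :
  hmx a a1 P -> (forall u, C u <-> exists2 v, B v & u = v *m P) ->
  regular c a B -> regular c.+1 a (fun v => B v /\ v *m P = 0) -> regular c a1 C.
Proof.
move=> hP CE [L resB] regA.
(* Lengthening by one makes a first term available, while the syzygies keep length [L]. *)
have [m' [a' [d [a'c hd Bd resK]]]] := fres_leL (leqnSn L) resB.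
apply: (regular_gen (d := d *m P) a'c); first exact: hmxM hd hP.
  move=> u; rewrite CE; split=> [[v /Bd[w ->] ->]|[w ->]].
    by exists w; rewrite mulmxA.
  by exists (w *m d); [apply/Bd; exists w|rewrite mulmxA].
apply: (regular_horseshoe hd (gsubmod_ker (hmxM hd hP)) _ _ regA).
  move=> u; split=> [[/Bd[w ->] wP]|[w wdP ->]]; first by exists w; rewrite ?mulmxA.
  by rewrite -mulmxA; split=> //; apply/Bd; exists w.
exists L; apply: fres_ext resK => w; rewrite mulmxA; split=> [wd|[]//].
by rewrite wd mul0mx.
Qed.

Lemma regular_cyclic c m (a : 'I_m -> nat) t (u : 'rV[S]_m) :
  (t <= c)%N -> hmx (fun=> t) a u -> (forall s : S, s *: u = 0 -> s = 0) ->
  regular c a (fun v => exists s : S, v = s *: u).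
Proof.
move=> tc hu u0; apply: (@regular_gen _ _ 1 (fun=> t) _ u) => //.
  move=> v; split=> [[s ->]|[w ->]].
    by exists s%:M; rewrite mul_scalar_mx.
  by exists (w 0 0); rewrite {1}[w]mx11_scalar mul_scalar_mx.
apply: regular_zero => w; split=> [|->]; last by rewrite mul0mx.
rewrite {1}[w]mx11_scalar mul_scalar_mx => /u0 w0.
by rewrite [w]mx11_scalar w0 raddf0.
Qed.

(* A syzygy with a nonzero constant coordinate [j] exhibits the generator [j]
   as redundant.  Dropping it replaces the syzygy module [K] by the quotient of
   [K] by the free cyclic module on that syzygy, which [regular_quot] controls. *)
Lemma regular_min c m (a : 'I_m -> nat) M :
  regular c a M ->
  exists m' (a' : 'I_m' -> nat) (d : 'M[S]_(m', m)),
    [/\ forall j, (a' j <= c)%N, hmx a' a d,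
        forall v, M v <-> exists w, v = w *m d,
        regular c.+1 a' (fun w => w *m d = 0)
      & forall (w : 'rV_m'), w *m d = 0 -> forall j, (w 0 j)@_0%MM = 0].
Proof.
case=> L /(fres_leL (leqnSn L)) [m' [a' [d [a'c hd Md resK]]]].
have {L resK} : regular c.+1 a' (fun w => w *m d = 0) by exists L.
elim: m' => [|m' IH] in a' d a'c hd Md *; move=> regK.
  by exists 0%N, a', d; split=> // w _ [].
have [[w [j [wd wj]]]|nex] :=
    classic (exists (w : 'rV_m'.+1) j, w *m d = 0 /\ (w 0 j)@_0%MM <> 0); last first.
  exists m'.+1, a', d; split=> // w wd j; apply: NNPP => wj.
  by apply: nex; exists w, j.
(* In the component of [w] of degree [a' j], coordinate [j] is the constant term of [w 0 j], a unit;
   scaling makes it 1. *)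
have [u [hu ud uj]] : exists u : 'rV[S]_m'.+1,
    [/\ hmx (fun=> a' j) a' u, u *m d = 0 & u 0 j = 1].
  exists (((w 0 j)@_0%MM)^-1%:MP *: vcomp a' (a' j) w); split.
  - move=> i l x; rewrite mxE mul_mpolyC => /msuppZ_le.
    by move: x; apply: hmx_vcomp.
  - by rewrite -scalemxAl -(vcompM _ _ hd) wd vcomp0 scaler0.
  apply/mpolyP => x; rewrite !mxE mcoeffCM mcoeff_mfilter mcoeff1.
  have -> : (mdeg x + a' j == a' j)%N = (x == 0%MM).
    by rewrite -mdeg_eq0 -{2}[a' j]add0n eqn_add2r.
  by case: eqP => [->|_]; rewrite ?mulr0 // mulVf //; apply/eqP.
(* [R] projects along [u] onto the vectors with coordinate [j] zero, [C] drops that coordinate and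
   [E] reinserts it as zero. Thus [P] identifies the quotient by [u] with a free module of rank
   [m']. *)
pose e : 'cV[S]_m'.+1 := delta_mx j 0.
pose R : 'M[S]_m'.+1 := 1%:M - e *m u.
pose C : 'M[S]_(m'.+1, m') := col' j 1%:M.
pose E : 'M[S]_(m', m'.+1) := row' j 1%:M.
pose P := R *m C.
pose a1 l := a' (lift j l).
have Ee : E *m e = 0.
  rewrite -colE; apply/colP => l; rewrite !mxE.
  by rewrite eq_sym (negbTE (neq_lift _ _)).
have EC : E *m C = 1%:M.
  apply/matrixP => l l'; transitivity ((1%:M : 'M[S]_m'.+1) (lift j l) (lift j l')).
    rewrite -[1%:M in RHS]mulmx1 !mxE; apply: eq_bigr => i _.
    by rewrite !mxE.
  by rewrite !mxE (inj_eq lift_inj).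
have CE : C *m E = 1%:M - e *m delta_mx 0 j.
  rewrite mul_delta_mx; apply/matrixP => i l.
  rewrite -[1%:M in RHS]mulmx1 !mxE [X in _ = X - _](bigD1_ord j) //= !mxE.
  rewrite -natrM mulnb addrAC [j == l]eq_sym subrr add0r.
  by apply: eq_bigr => i' _; rewrite !mxE.
have ve v : v *m e = (v 0 j)%:M.
  by rewrite -colE [LHS]mx11_scalar mxE.
have vR v : v *m R = v - v 0 j *: u.
  by rewrite mulmxBr mulmx1 mulmxA ve mul_scalar_mx.
have uR : u *m R = 0 by rewrite vR uj scale1r subrr.
have Rd : R *m d = d by rewrite mulmxBl mul1mx -mulmxA ud mulmx0 subr0.
have Re : R *m e = 0 by rewrite mulmxBl mul1mx -mulmxA ve uj mulmx1 subrr.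
have RCE : R *m C *m E = R.
  by rewrite -mulmxA CE mulmxBr mulmx1 mulmxA Re mul0mx subr0.
have ER : E *m R = E by rewrite mulmxBr mulmx1 mulmxA Ee mul0mx subr0.
have hE : hmx a1 a' E by move=> l i; rewrite mxE; apply: hmx1.
have hC : hmx a' a1 C by move=> i l; rewrite mxE; apply: hmx1.
have he : hmx a' (fun=> a' j) e.
  move=> i i'; rewrite mxE ord1 andbT.
  by case: eqP => [->|_]; [exact: shomog1|exact: shomog0].
have hP : hmx a' a1 P.
  apply: hmxM hC; apply: hmxD; first exact: hmx1.
  by apply: hmxN; apply: hmxM he hu.
apply: (IH a1 (E *m d)); first by move=> l; apply: a'c.
- exact: hmxM hE hd.
- move=> v; rewrite Md; split=> [[x ->]|[x ->]]; last first.
    by exists (x *m E); rewrite mulmxA.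
  by exists (x *m P); rewrite -mulmxA (mulmxA P) RCE Rd.
(* The syzygies of [E *m d] are the image under [P] of those of [d]; the kernel of [P] is the free
   cyclic module on [u]. *)
apply: (regular_quot hP _ regK).
  move=> x; split=> [xEd|[v vd ->]]; last by rewrite -mulmxA (mulmxA P) RCE Rd.
  exists (x *m E); first by rewrite -mulmxA.
  by rewrite /P mulmxA -(mulmxA x) ER -mulmxA EC mulmx1.
apply: (@regular_ext _ _ _ (fun v => exists s : S, v = s *: u)); last first.
  (* The syzygies live at level [c.+1], so the submodule divided out is wanted at level [c.+2]. *)
  have le_c : (a' j <= c.+2)%N by apply: leq_trans (a'c j) _; rewrite !leqW.
  apply: (regular_cyclic le_c hu) => s /(congr1 (fun v : 'rV_m'.+1 => v 0 j)).
  by rewrite !mxE uj mulr1.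
move=> v; split=> [[s ->]|[vd vP]].
  by rewrite -!scalemxAl ud /P mulmxA uR mul0mx !scaler0.
exists (v 0 j); apply/eqP; rewrite -subr_eq0 -vR -RCE mulmxA.
by rewrite (vP : v *m (R *m C) = 0) mul0mx.
Qed.
End Resolutions.

(** * Splicing minimal generating sets into a minimal resolution *)

Section MinimalResolution.
Context (n : nat) (k : fieldType).
Local Notation S := {mpoly k[n]}.

(** Bundling rank, degrees and module lets the successive syzygy modules, whose ambient ranks depend
    on earlier choices, be produced by iterating one function. *)
Record stage (c : nat) := Stage {
  st_rank : nat;
  st_deg : 'I_st_rank -> nat;
  st_mod : 'rV[S]_st_rank -> Prop;
  st_regular : regular c st_deg st_mod }.

Record mingens c (s : stage c) := MinGens {
  mg_rank : nat;
  mg_deg : 'I_mg_rank -> nat;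
  mg_mx : 'M[S]_(mg_rank, st_rank s);
  mg_le : forall j, (mg_deg j <= c)%N;
  mg_hom : hmx mg_deg (@st_deg _ s) mg_mx;
  mg_span : forall v, st_mod v <-> exists w, v = w *m mg_mx;
  mg_regular : regular c.+1 mg_deg (fun w => w *m mg_mx = 0);
  mg_min : forall w : 'rV_mg_rank, w *m mg_mx = 0 -> forall j, (w 0 j)@_0%MM = 0 }.

Lemma mingens_exist c (s : stage c) : exists _ : mingens s, True.
Proof.
have [m' [a' [d [*]]]] := regular_min (st_regular s).
by unshelve eexists; first exists m' a' d.
Qed.

Definition gens c (s : stage c) : mingens s :=
  proj1_sig (constructive_indefinite_description _ (mingens_exist s)).

Definition next c (s : stage c) : stage c.+1 := Stage (mg_regular (gens s)).

(** With the bound written [i + c], the successor case has the type of [next] by computation. *)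
Fixpoint syz c (s : stage c) i : stage (i + c) :=
  if i is i'.+1 then next (syz s i') else s.

Lemma shomog_homog_of a t (p : S) : shomog a t p -> homog_of (t - a) p.
Proof. by move=> hp; apply/dhomogP => m /hp <-; rewrite addnK. Qed.

Lemma shomog_lt a t (p : S) :
  shomog a t p -> p@_0%MM = 0 -> p != 0 -> (a < t)%N.
Proof.
move=> hp p0 /mlead_supp lp; rewrite -(hp _ lp) -[ltnLHS]add0n ltn_add2r lt0n.
by rewrite mdeg_eq0; apply: contraL lp => /eqP->; rewrite -mcoeff_eq0 p0.
Qed.

Lemma regular_reg_le (I : S -> Prop) b :
  regular b (fun _ : 'I_1 => 0%N) (fun v => I (v 0 0)) -> reg_le I b.
Proof.
move=> regI; pose s := Stage regI.
pose r i := mg_rank (gens (syz s i)).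
pose deg i (l : 'I_(r i)) : nat := mg_deg l.
(* Shifts are indexed by all naturals in [reg_le]; the default 0 fills the indices beyond the
   rank. *)
pose a i l := oapp (deg i) 0%N (insub l).
have aE i (l : 'I_(r i)) : a i l = mg_deg l by rewrite /a valK.
exists r, a, (mg_mx (gens (syz s 0))), (fun i => mg_mx (gens (syz s i.+1))).
split; last by move=> i j; rewrite aE; apply: mg_le.
split=> [j|]; first by rewrite aE -[mg_deg j]subn0; apply/shomog_homog_of/mg_hom.
split=> [i j l|].
  have hd := @mg_hom _ _ (gens (syz s i.+1)) j l.
  rewrite !aE; split; first exact: shomog_homog_of.
  apply: shomog_lt => //.
  (* The rows of each differential are syzygies of the preceding generators, so minimality there
     removes their constant terms. *)
  have /mg_min/(_ l) :
      row j (mg_mx (gens (syz s i.+1))) *m mg_mx (gens (syz s i)) = 0.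
    by apply/(mg_span (gens (syz s i.+1))); exists (delta_mx 0 j); rewrite rowE.
  by rewrite mxE.
split=> [p|]; last by split=> [v|i v]; [exact: (mg_span (gens (syz s 1)))
                                       |exact: (mg_span (gens (syz s i.+2)))].
have := mg_span (gens (syz s 0)) p%:M; rewrite /= mxE eqxx mulr1n => ->.
split=> [[w wE]|[w ->]]; exists w; first by rewrite -wE mxE eqxx mulr1n.
by rewrite [RHS]mx11_scalar.
Qed.

End MinimalResolution.

(** * Ideals spanned by monomials *)

Section MonomialIdeals.
Context (n : nat) (k : fieldType).
Local Notation S := {mpoly k[n]}.
Implicit Types (Q : pred 'X_{1..n}) (p q : S).

Definition supported Q p := {in msupp p, forall m, Q m}.

Definition upclosed Q := forall m m', Q m -> Q (m + m')%MM.

Definition mregular c Q :=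
  regular c (fun _ : 'I_1 => 0%N) (fun v : 'rV[S]_1 => supported Q (v 0 0)).

Lemma supported0 Q : supported Q 0.
Proof. by move=> m; rewrite msupp0. Qed.

Lemma supportedD Q p q : supported Q p -> supported Q q -> supported Q (p + q).
Proof. by move=> hp hq m /msuppD_le; rewrite mem_cat => /orP[/hp|/hq]. Qed.

Lemma supportedN Q p : supported Q p -> supported Q (- p).
Proof. by move=> hp m; rewrite (perm_mem (msuppN p)); apply: hp. Qed.

Lemma supportedM Q p q : upclosed Q -> supported Q q -> supported Q (p * q).
Proof.
move=> uQ hq m /msuppM_le /allpairsP[[m1 m2] /= [_ /hq h2 ->]].
by rewrite addmC; apply: uQ.
Qed.

Lemma supported_mfilter Q P p : supported Q p -> supported Q (mfilter P p).
Proof.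
move=> hp m; rewrite mcoeff_msupp mcoeff_mfilter.
by case: ifP => _; [rewrite -mcoeff_msupp; apply: hp|rewrite eqxx].
Qed.

Lemma supported_divX Q x p :
  {in msupp p, forall m : 'X_{1..n}, (0 < m x)%N && Q (m - U_(x))%MM} ->
  exists2 q, supported Q q & p = q * 'X_x.
Proof.
move=> hp; exists (\sum_(m <- msupp p) p@_m *: 'X_[m - U_(x)]).
  move=> m /msupp_sum_le /flattenP[s /mapP[m' m'p ->]] /msuppZ_le.
  move: m'p; rewrite mem_filter /= => m'p.
  by rewrite msuppX inE => /eqP->; have /andP[] := hp _ m'p.
rewrite {1}[p]mpolyE mulr_suml; apply: eq_big_seq => m /hp /andP[mx _].
rewrite -scalerAl -mpolyXD submK //.
by apply/mnm_lepP => i; rewrite mnm1E; case: eqP => [<-|].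
Qed.

(** This is the nonzerodivisor property of [x] modulo the ideal spanned by [Q]. *)
Lemma supported_mulX Q x q :
  (forall m, Q (m + U_(x))%MM = Q m) -> supported Q (q * 'X_x) -> supported Q q.
Proof.
move=> Qx hq m; rewrite mcoeff_msupp -(mcoeffMX q U_(x)) -mcoeff_msupp.
by rewrite addmC => /hq; rewrite Qx.
Qed.

Lemma mregular_ext c Q Q' : Q =1 Q' -> mregular c Q -> mregular c Q'.
Proof.
by move=> eQ; apply: regular_ext => v; split=> hv m /hv; rewrite eQ.
Qed.

Lemma mregular_pred0 c Q : Q =1 pred0 -> mregular c Q.
Proof.
move=> Q0; apply: regular_zero => v; split=> [hv|->]; last first.
  by rewrite mxE; apply: supported0.
rewrite [v]mx11_scalar; suff -> : v 0 0 = 0 by rewrite raddf0.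
apply: msuppnil0; case E: (msupp _) => [//|m s].
by have := hv m; rewrite E mem_head Q0 => /(_ isT).
Qed.

Lemma mregular_predT c : mregular c predT.
Proof.
apply: (@regular_gen _ _ _ _ _ (fun=> 0%N) _ 1%:M) => //; first exact: hmx1.
  by move=> v; split=> // _; exists v; rewrite mulmx1.
by apply: regular_zero => w; rewrite mulmx1.
Qed.

(* With [I'] spanned by [Q'], [K] by [QK] and [I] by [Q], the hypotheses say that
   [I = I' + x K], [I' <= K] and that [x] is a nonzerodivisor modulo [I'], whence
   an exact sequence [0 -> I'(-1) -> I' (+) K(-1) -> I -> 0]. *)
Lemma mregular_step c x Q Q' QK :
  upclosed Q' -> upclosed QK -> {subset Q' <= QK} ->
  (forall m : 'X_{1..n}, Q m = Q' m || (0 < m x)%N && QK (m - U_(x))%MM) ->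
  (forall m, Q' (m + U_(x))%MM = Q' m) ->
  mregular c.+1 Q' -> mregular c QK -> mregular c.+1 Q.
Proof.
move=> uQ' uQK subQ QE Q'x reg' regK.
(* [B] is the direct sum of [I'] and [K(-1)]; the twist is the basis degree 1 of the second
   summand. *)
pose a0 (_ : 'I_1) := 0%N; pose a1 (_ : 'I_1) := 1%N.
pose a := dcat a0 a1.
pose B (v : 'rV[S]_(1 + 1)) :=
  supported Q' (lsubmx v 0 0) /\ supported QK (rsubmx v 0 0).
have gB : gsubmod a B.
  split=> [v w [] + + []|s v []|t v []]; rewrite /B !mxE => *; split;
    by [apply: supportedD|apply: supportedM|apply: supported_mfilter].
have vcolE (X Y : 'M[S]_1) (v : 'rV[S]_(1 + 1)) :
    v *m col_mx X Y = lsubmx v *m X + rsubmx v *m Y.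
  by rewrite -{1}[v]hsubmxK mul_row_col.
have x00 (v : 'M[S]_1) p : (v *m p%:M) 0 0 = v 0 0 * p.
  by rewrite mxE big_ord1 mxE eqxx.
have hX : hmx a1 a0 ('X_x : S)%:M.
  by move=> i j; rewrite !ord1 mxE eqxx; apply: shomogX.
have regB : regular c.+1 a B.
  have hP : hmx a a1 (col_mx 0 1%:M : 'M[S]__).
    by apply: hmx_col; [exact: hmx0|exact: hmx1].
  have hJ : hmx a0 a (row_mx 1%:M 0 : 'M[S]__).
    by apply: hmx_row; [exact: hmx1|exact: hmx0].
  apply: (regular_horseshoe (C := fun u => supported QK (u 0 0)) hP gB).
  - move=> u; split=> [hu|[v [_ v2] ->]]; last by rewrite vcolE mulmx0 add0r mulmx1.
    exists (row_mx 0 u); last by rewrite mul_row_col mulmx0 add0r mulmx1.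
    by rewrite /B row_mxKl row_mxKr mxE; split=> //; apply: supported0.
  - apply: regular_ext (regular_inj hJ _ reg') => v.
      rewrite vcolE mulmx0 add0r mulmx1; split=> [[w hw ->]|[[v1 _] v2]].
        rewrite mul_mx_row mulmx1 mulmx0 /B row_mxKl row_mxKr mxE.
        by split=> //; split=> //; apply: supported0.
      by exists (lsubmx v); rewrite // mul_mx_row mulmx1 mulmx0 -{1}[v]hsubmxK v2.
    move=> _; rewrite mul_mx_row mulmx1 => /(congr1 lsubmx).
    by rewrite row_mxKl linear0.
  - exact: regular_shift regK.
(* The surjection onto [I] is [(p, q) |-> p + x q], and its kernel is the image of [I'(-1)] under
   [w |-> (- x w, w)]. *)
have hP : hmx a a0 (col_mx 1%:M ('X_x : S)%:M) by apply: hmx_col => //; exact: hmx1.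
have hJ : hmx a1 a (row_mx (- ('X_x : S)%:M) 1%:M).
  by apply: hmx_row; [exact: hmxN|exact: hmx1].
apply: (regular_quot hP _ regB) => [u|].
  split=> [hu|[v [v1 v2] ->]]; last first.
    rewrite vcolE mulmx1 mxE x00; apply: supportedD => m.
      by move/v1; rewrite QE => ->.
    move=> /msuppM_le /allpairsP[[m1 m2] /= [/v2 h1 + ->]].
    rewrite msuppX inE => /eqP->; rewrite QE mnmDE mnm1E eqxx addn1 /= addmK.
    by rewrite h1 orbT.
  (* The terms of [u] outside [I'] are all divisible by [x] with quotient in [K]. *)
  have [|q hq qE] := @supported_divX QK x (u 0 0 - mfilter Q' (u 0 0)).
    move=> m; rewrite mcoeff_msupp mcoeffB mcoeff_mfilter.
    case: ifPn => [|nQ']; first by rewrite subrr eqxx.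
    by rewrite subr0 -mcoeff_msupp => /hu; rewrite QE (negbTE nQ').
  exists (row_mx (mfilter Q' (u 0 0))%:M q%:M).
    rewrite /B row_mxKl row_mxKr !mxE eqxx !mulr1n; split=> // m.
    by rewrite mcoeff_msupp mcoeff_mfilter; case: ifP => //; rewrite eqxx.
  rewrite mul_row_col mulmx1 [u in LHS]mx11_scalar -scalar_mxM -qE -raddfD.
  by rewrite addrC subrK.
apply: regular_ext (regular_inj hJ _ (regular_shift reg')) => v; last first.
  move=> _; rewrite mul_mx_row mulmx1 => /(congr1 rsubmx).
  by rewrite row_mxKr linear0.
rewrite vcolE mulmx1; split=> [[w hw ->]|[[v1 v2] /eqP]].
  rewrite mul_mx_row mulmx1 mulmxN /B row_mxKl row_mxKr addNr mxE x00.
  split=> //; split; last by move=> m /hw /subQ.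
  by apply: supportedN; rewrite mulrC; apply: supportedM.
rewrite addr_eq0 => /eqP vE; exists (rsubmx v).
  apply: (supported_mulX Q'x); rewrite -x00 -[_ *m _]opprK -vE mxE.
  exact: supportedN.
by rewrite mul_mx_row mulmx1 mulmxN -vE hsubmxK.
Qed.

End MonomialIdeals.

(** * Edge ideals of graphs *)

Section EdgeIdeals.
Context (n : nat) (k : fieldType) (e : rel 'I_n).
Context (e_sym : ssrbool.symmetric e) (e_irr : irreflexive e).
Implicit Types (U V W : {set 'I_n}) (m : 'X_{1..n}).

Definition has_var V m := [exists i in V, 0 < m i]%N.

Definition has_edge W m :=
  [exists i in W, exists j in W, [&& e i j, 0 < m i & 0 < m j]]%N.

(* Membership of a monomial in the ideal generated by the variables in [V] and the
   edges inside [W]. *)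
Definition vars_edges V W m := has_var V m || has_edge W m.

Lemma has_varP V m :
  reflect (exists2 i, i \in V & (0 < m i)%N) (has_var V m).
Proof. exact: exists_inP. Qed.

Lemma has_edgeP W m :
  reflect (exists i j, [/\ i \in W, j \in W, e i j, (0 < m i)%N & (0 < m j)%N])
          (has_edge W m).
Proof.
apply: (iffP exists_inP) => [[i iW /exists_inP[j jW /and3P[*]]]|].
  by exists i, j.
move=> [i [j [iW jW eij mi mj]]].
by exists i => //; apply/exists_inP; exists j; rewrite // eij mi.
Qed.

Lemma vars_edges_upclosed V W : upclosed (vars_edges V W).
Proof.
move=> m m' /orP[/has_varP[i iV mi]|/has_edgeP[i [j [iW jW eij mi mj]]]]; apply/orP.
  by left; apply/has_varP; exists i; rewrite // mnmDE addn_gt0 mi.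
by right; apply/has_edgeP; exists i, j; rewrite !mnmDE !addn_gt0 mi mj; split.
Qed.

Lemma vars_edges_addX V W x m :
  x \notin V -> x \notin W ->
  vars_edges V W (m + U_(x))%MM = vars_edges V W m.
Proof.
move=> xV xW.
have mE i : i != x -> (m + U_(x))%MM i = m i.
  by move=> ix; rewrite mnmDE mnm1E eq_sym (negbTE ix) addn0.
have ne (A : {set 'I_n}) i : x \notin A -> i \in A -> i != x.
  by move=> xA iA; apply: contraNneq xA => <-.
congr (_ || _).
  by apply: eq_existsb => i; case: (boolP (i \in V)) => //= /(ne _ _ xV)/mE->.
apply: eq_existsb => i; case: (boolP (i \in W)) => //= /(ne _ _ xW)/mE->.
by apply: eq_existsb => j; case: (boolP (j \in W)) => //= /(ne _ _ xW)/mE->.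
Qed.

(** Variables are adjoined one at a time by [mregular_step], with the whole ring as [K]. The ring is
    bounded at every level, so only the positivity of [c.+1] is consumed. *)
Lemma mregular_vars c V W :
  [disjoint V & W] -> mregular k c.+1 (has_edge W) ->
  mregular k c.+1 (vars_edges V W).
Proof.
have [N leN] := ubnP #|V|; elim: N => // N IH in V leN * => VW regW.
have [->|[x xV]] := set_0Vmem V.
  apply: mregular_ext regW => m; rewrite /vars_edges.
  by case: has_varP => // -[i]; rewrite inE.
have xW : x \notin W.
  by apply: contraTN VW => xW; apply/pred0Pn; exists x; apply/andP.
apply: (@mregular_step _ _ _ x _ (vars_edges (V :\ x) W) predT) => //.
- exact: vars_edges_upclosed.
- move=> m; rewrite andbT /vars_edges orbAC; congr (_ || _).
  apply/has_varP/orP => [[i iV mi]|[/has_varP[i /setD1P[_ iV] mi]|mx]].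
  + case: (eqVneq i x) => [<-|ix]; first by right.
    by left; apply/has_varP; exists i => //; apply/setD1P.
  + by exists i.
  + by exists x.
- by move=> m; apply: vars_edges_addX; rewrite ?setD11.
- apply: IH => //; first by move: leN; rewrite (cardsD1 x) xV.
  by apply: disjointWl VW; apply: subsetDl.
- exact: mregular_predT.
Qed.

Definition nonnbrs W x := [set y in W :\ x | ~~ e x y].

Lemma mregular_edges_step c W x :
  x \in W ->
  mregular k c.+2 (has_edge (W :\ x)) -> mregular k c.+1 (has_edge (nonnbrs W x)) ->
  mregular k c.+2 (has_edge W).
Proof.
move=> xW regD regN; pose V := [set y in W | e x y].
have dVN : [disjoint V & nonnbrs W x].
  apply/pred0P => i; rewrite !inE /=; apply/negbTE.
  by case: (e x i); rewrite ?andbF ?andFb.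
(* Writing [I'] with an empty set of variables gives it the same shape as [K], so both obey the
   general facts on [vars_edges]. *)
apply: (@mregular_step _ _ _ x _ (vars_edges set0 (W :\ x))
          (vars_edges V (nonnbrs W x))).
- exact: vars_edges_upclosed.
- exact: vars_edges_upclosed.
- move=> m /orP[/has_varP[i]|]; first by rewrite inE.
  case/has_edgeP=> i [j [iW jW eij mi mj]]; apply/orP.
  (* For [I' <= K]: an edge meeting the neighbours of [x] contains a variable of [K]; any other edge
     of [W :\ x] lies in [nonnbrs W x]. *)
  have [xi|nxi] := boolP (e x i).
    by left; apply/has_varP; exists i => //; rewrite inE xi andbT; case/setD1P: iW.
  have [xj|nxj] := boolP (e x j).
    by left; apply/has_varP; exists j => //; rewrite inE xj andbT; case/setD1P: jW.
  by right; apply/has_edgeP; exists i, j; split=> //; rewrite inE ?iW ?jW.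
- move=> m; apply/idP/orP.
    case/has_edgeP=> i [j [iW jW eij mi mj]].
    have edge_x y : y \in W -> e x y -> (0 < m x)%N -> (0 < m y)%N ->
        (0 < m x)%N && vars_edges V (nonnbrs W x) (m - U_(x))%MM.
      move=> yW exy mx my; rewrite mx; apply/orP; left; apply/has_varP; exists y.
        by rewrite inE yW.
      rewrite mnmBE mnm1E; case: eqP => [xy|_]; last by rewrite subn0.
      by rewrite xy e_irr in exy.
    case: (eqVneq i x) => [ix|nix].
      by right; apply: (edge_x j) => //; rewrite -ix.
    case: (eqVneq j x) => [jx|njx].
      by right; apply: (edge_x i) => //; rewrite -jx // e_sym.
    left; apply/orP; right; apply/has_edgeP; exists i, j.
    by split=> //; apply/setD1P.
  case=> [/orP[/has_varP[i]|/has_edgeP]|]; first by rewrite inE.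
    move=> [i [j [/setD1P[_ iW] /setD1P[_ jW] eij mi mj]]].
    by apply/has_edgeP; exists i, j.
  case/andP=> mx /orP[/has_varP[y]|/has_edgeP[i [j []]]].
    rewrite inE mnmBE => /andP[yW exy] my; apply/has_edgeP; exists x, y.
    by split=> //; apply: leq_trans my (leq_subr _ _).
  rewrite !mnmBE => /setIdP[/setD1P[_ iW] _] /setIdP[/setD1P[_ jW] _] eij mi mj.
  by apply/has_edgeP; exists i, j; split=> //;
     apply: leq_trans (leq_subr _ _); eassumption.
- by move=> m; apply: vars_edges_addX; rewrite ?setD11 // inE.
- by apply: mregular_vars regD; rewrite -setI_eq0 set0I.
- exact: mregular_vars.
Qed.

Lemma mregular_edgeless c W :
  (forall u v, u \in W -> v \in W -> ~~ e u v) -> mregular k c (has_edge W).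
Proof.
move=> W0; apply: mregular_pred0 => m; apply/has_edgeP => -[i [j [iW jW eij _ _]]].
by case/negP: (W0 i j iW jW).
Qed.

Definition gapless := forall p q r s,
  e p q -> e r s -> [|| e p r, e p s, e q r | e q s].

(** The cricket has centre [y], triangle [y u v] and leaves [x], [w]. Adjacency does not separate
    the two leaves, hence the condition [x != w]. *)
Definition cricketless := forall y x u v w,
  x != w -> e y x -> e y u -> e y v -> e y w -> e u v ->
  [|| e x u, e x v, e x w, e u w | e v w].

(* Relative to [y], [U] splits into an edgeless part (the non-neighbours of [y])
   and a complete multipartite part (the neighbours).  A neighbour [t] of [y] with
   fewest non-neighbours in the edgeless part has an edgeless set of
   non-neighbours in [U], i.e. it is simplicial in the complement graph. *)
Lemma mregular2 U y :
  gapless ->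
  (forall u v, u \in U -> v \in U -> ~~ e y u -> ~~ e y v -> ~~ e u v) ->
  (forall u v w, u \in U -> v \in U -> w \in U ->
     e y u -> e y v -> e y w -> e u v -> e u w || e v w) ->
  mregular k 2 (has_edge U).
Proof.
move=> gapl.
have [N leN] := ubnP #|U|; elim: N => // N IH in U leN * => indep multi.
pose g t := #|[set c in U | ~~ e y c & ~~ e t c]|.
have [/existsP[t0 t0P]|/existsPn noT] :=
  boolP [exists t, (t \in U) && e y t]; last first.
  by apply: mregular_edgeless => u v uU vU; apply: indep => //;
     [have := noT u|have := noT v]; rewrite ?uU ?vU.
have [t /andP[tU yt] tmin] := @arg_minnP _ t0 (fun t => (t \in U) && e y t) g t0P.
apply: (mregular_edges_step tU).
  apply: IH => [|u v /setD1P[_ uU] /setD1P[_ vU]|u v w].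
  - by move: leN; rewrite (cardsD1 t) tU.
  - exact: indep.
  - by move=> /setD1P[_ uU] /setD1P[_ vU] /setD1P[_ wU]; apply: multi.
have mixed u v :
    u \in nonnbrs U t -> v \in nonnbrs U t -> e y u -> ~~ e y v -> ~~ e u v.
  move=> /setIdP[/setD1P[_ uU] tu] /setIdP[/setD1P[_ vU] tv] yu yv.
  apply/negP => uv.
  (* The vertex [v] is missed by [t] but not by [u]. By minimality of [g t], [u] must in turn miss
     some [c] of the edgeless part that [t] meets. *)
  have /subsetPn[c] : ~~ ([set c in U | ~~ e y c & ~~ e u c] \subset
                          [set c in U | ~~ e y c & ~~ e t c]).
    apply/negP => sub.
    have : (g u < g t)%N.
      apply/proper_card/properP; split=> //; exists v; rewrite !inE vU yv //=.
      by rewrite uv.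
    by rewrite ltnNge tmin ?uU.
  rewrite !inE => /and3P[cU yc uc]; rewrite cU yc /= negbK => tc.
  (* The edges [u v] and [t c] now form a gap. *)
  have := gapl u v t c uv tc.
  by rewrite [e u t]e_sym [e v t]e_sym (negbTE tu) (negbTE tv)
             (negbTE uc) (negbTE (indep _ _ vU cU yv yc)).
apply: mregular_edgeless => u v uN vN.
have /setIdP[/setD1P[_ uU] tu] := uN; have /setIdP[/setD1P[_ vU] tv] := vN.
have [yu|yu] := boolP (e y u); have [yv|yv] := boolP (e y v).
(* Two neighbours of [y] not adjacent to [t] lie in the same part as [t]. *)
- apply/negP => /(multi u v t uU vU tU yu yv yt).
  by rewrite e_sym (negbTE tu) e_sym (negbTE tv).
- exact: mixed.
- by rewrite e_sym; apply: mixed.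
- exact: indep.
Qed.

Lemma mregular3 W :
  gapless -> cricketless -> mregular k 3 (has_edge W).
Proof.
move=> gapl crick.
have [N leN] := ubnP #|W|; elim: N => // N IH in W leN *.
have [/exists_inP[x xW /exists_inP[y yW xy]]|/exists_inPn noE] :=
  boolP [exists x in W, exists y in W, e x y]; last first.
  by apply: mregular_edgeless => u v /noE /exists_inPn; apply.
apply: (mregular_edges_step xW).
  by apply: IH; move: leN; rewrite (cardsD1 x) xW.
apply: (@mregular2 _ y) => // [u v|u v w].
  move=> /setIdP[_ xu] /setIdP[_ xv] yu yv; apply/negP => uv.
  by have := gapl x y u v xy uv;
     rewrite (negbTE xu) (negbTE xv) (negbTE yu) (negbTE yv).
move=> /setIdP[_ xu] /setIdP[_ xv] /setIdP[/setD1P[wx _] xw] yu yv yw uv.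
have := crick y x u v w; rewrite eq_sym (e_sym y) wx xy yu yv yw uv.
by rewrite (negbTE xu) (negbTE xv) (negbTE xw) => /(_ isT isT isT isT isT isT).
Qed.

(** The edge ideal is generated by monomials, so membership is decided term by term. *)
Lemma in_edge_ideal_supported (p : {mpoly k[n]}) :
  in_edge_ideal k e p <-> supported (has_edge setT) p.
Proof.
have edgeXX i j : e i j -> has_edge setT (U_(i) + U_(j))%MM.
  move=> eij; apply/has_edgeP; exists i, j.
  by split=> //; rewrite mnmDE !mnm1E eqxx ?addn1.
have up : upclosed (has_edge setT).
  by move=> m m' /has_edgeP[i [j [_ _ eij mi mj]]]; apply/has_edgeP; exists i, j;
     rewrite !mnmDE !addn_gt0 mi mj !inE.
split=> [[c ->]|hp].
  have sum I (r : seq I) (P : pred I) (F : I -> {mpoly k[n]}) :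
      (forall i, P i -> supported (has_edge setT) (F i)) ->
      supported (has_edge setT) (\sum_(i <- r | P i) F i).
    move=> hF; elim/big_ind: _ => //; [exact: supported0|exact: supportedD].
  apply: (sum) => i _; apply: (sum) => j eij; apply: supportedM => // m.
  by rewrite -mpolyXD msuppX inE => /eqP->; apply: edgeXX.
rewrite [p]mpolyE big_seq; elim/big_ind: _ => [|q1 q2 [c1 ->] [c2 ->]|m /hp].
- exists (fun _ _ => 0); rewrite big1 // => i _.
  by rewrite big1 // => j _; rewrite mul0r.
- exists (fun i j => c1 i j + c2 i j); rewrite -big_split; apply: eq_bigr => i _.
  by rewrite -big_split; apply: eq_bigr => j _; rewrite /= mulrDl.
case/has_edgeP=> [i [j [_ _ eij mi mj]]].
(* Irreflexivity gives [i != j]; otherwise a square would have to divide [m]. *)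
have le_m : (U_(i) + U_(j) <= m)%MM.
  apply/mnm_lepP => l; rewrite mnmDE !mnm1E.
  case: (eqVneq i l) => [il|_]; last by case: eqP => [<-|].
  case: eqP => [jl|_]; last by rewrite addn0 -il.
  by move: eij; rewrite il jl e_irr.
exists (fun i' j' => if (i' == i) && (j' == j)
                     then p@_m *: 'X_[m - (U_(i) + U_(j))] else 0).
rewrite (bigD1 i) //= [X in _ + X]big1 => [|i' /negbTE i'i]; last first.
  by rewrite big1 // => j' _; rewrite i'i mul0r.
rewrite (bigD1 j) //= [X in _ + X + _]big1 => [|j' /andP[_ /negbTE j'j]].
  by rewrite !eqxx !addr0 -scalerAl -mpolyXD -mpolyXD submK.
by rewrite j'j andbF mul0r.
Qed.

End EdgeIdeals.

(** * From forbidden induced subgraphs to conditions on edges *)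

Lemma gap_free_gapless n (e : rel 'I_n) :
  simple_graph e -> gap_free e -> gapless e.
Proof.
move=> [e_sym e_irr] gapf p q r s epq ers; apply/negPn/negP.
rewrite !negb_or => /and4P[/negbTE pr /negbTE ps /negbTE qr /negbTE qs].
have irr x : e x x = false by apply/negbTE.
(* Identifying two of the vertices would turn one of the given edges into a loop or into an excluded
   edge. *)
have uniq_l : uniq [:: p; q; r; s].
  rewrite /= !inE !negb_or !andbT -!andbA; do ![apply/andP; split].
  - by apply: contraTneq epq => ->; rewrite irr.
  - by apply: contraTneq ers => <-; rewrite ps.
  - by apply: contraTneq ers => <-; rewrite e_sym pr.
  - by apply: contraTneq ers => <-; rewrite qs.
  - by apply: contraTneq ers => <-; rewrite e_sym qr.
  - by apply: contraTneq ers => ->; rewrite irr.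
apply: gapf; exists (fun i : 'I_4 => nth p [:: p; q; r; s] i); split.
  move=> i j /eqP; rewrite nth_uniq // => /eqP; exact: val_inj.
move=> [[|[|[|[|//]]]] hi] [[|[|[|[|//]]]] hj];
  by rewrite /twoK2 /= ?irr ?pr ?ps ?qr ?qs ?epq ?ers //
             e_sym ?pr ?ps ?qr ?qs ?epq ?ers.
Qed.

Lemma cricket_free_cricketless n (e : rel 'I_n) :
  simple_graph e -> cricket_free e -> cricketless e.
Proof.
move=> [e_sym e_irr] crickf y x u v w xw yx yu yv yw uv; apply/negPn/negP.
rewrite !negb_or => /and5P[/negbTE xu /negbTE xv /negbTE xw' /negbTE uw /negbTE vw].
have irr z : e z z = false by apply/negbTE.
have uniq_l : uniq [:: y; u; v; w; x].
  rewrite /= !inE !negb_or !andbT -!andbA.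
  do ![apply/andP; split].
  - by apply: contraTneq yu => ->; rewrite irr.
  - by apply: contraTneq yv => ->; rewrite irr.
  - by apply: contraTneq yw => ->; rewrite irr.
  - by apply: contraTneq yx => ->; rewrite irr.
  - by apply: contraTneq uv => ->; rewrite irr.
  - by apply: contraTneq uv => ->; rewrite e_sym vw.
  - by apply: contraTneq uv => ->; rewrite xv.
  - by apply: contraTneq uv => ->; rewrite uw.
  - by apply: contraTneq uv => ->; rewrite e_sym xu.
  - by rewrite eq_sym.
apply: crickf; exists (fun i : 'I_5 => nth y [:: y; u; v; w; x] i); split.
  move=> i j /eqP; rewrite nth_uniq // => /eqP; exact: val_inj.
move=> [[|[|[|[|[|//]]]]] hi] [[|[|[|[|[|//]]]]] hj];
  by rewrite /cricket /= ?irr ?xu ?xv ?xw' ?uw ?vw ?yx ?yu ?yv ?yw ?uv //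
             e_sym ?xu ?xv ?xw' ?uw ?vw ?yx ?yu ?yv ?yw ?uv.
Qed.

Theorem theorem3p4 (k : fieldType) (n : nat) (e : rel 'I_n) :
  simple_graph e -> cricket_free e -> gap_free e ->
  reg_le (in_edge_ideal k e) 3.
Proof.
move=> Ge crickf gapf; have [e_sym e_irr] := Ge.
have irr : irreflexive e by move=> x; apply/negbTE.
apply: regular_reg_le.
apply: regular_ext (mregular3 k e_sym irr setT (gap_free_gapless Ge gapf)
                      (cricket_free_cricketless Ge crickf)) => v.
by rewrite in_edge_ideal_supported.
Qed.
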